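(* Let $Z=A\cdot[0,1]^n\subseteq\mathbb{R}^d$ be a unimodular zonotope and $L=\operatorname{rowspace}(A)\otimes\mathbb{C}\subseteq\mathbb{C}^n$. The harmonic algebra $\mathcal{H}_Z$ is isomorphic, as a bigraded $\mathbb{C}$-algebra, to the bigraded homogeneous coordinate ring $\mathbb{C}[z_S:S\subseteq[n]]/I(\Phi(Y_L))$ of the image of the arrangement Schubert variety $Y_L$ under the Segre embedding $\Phi:(\mathbb{P}^1)^n\to\mathbb{P}^{2^n-1}$, where $z_S$ has bidegree $(1,|S|)$ and $I(\Phi(Y_L))$ is the homogeneous vanishing ideal.
   Context: A unimodular zonotope is $Z=A\cdot[0,1]^n\subseteq\mathbb{R}^d$ where $A$ is a $d\times n$ integer matrix of rank $d$ all of whose maximal minors lie in $\{-1,0,1\}$. For a finite $\mathcal{Z}\subseteq\mathbb{Z}^d\subseteq\mathbb{C}^d$, $\operatorname{gr}I(\mathcal{Z})\subseteq\mathbb{C}[x_1,\dots,x_d]$ is the ideal generated by top-degree homogeneous components of polynomials vanishing on $\mathcal{Z}$. For a homogeneous ideal $I\subseteq\mathbb{C}[x_1,\dots,x_d]$, the Macaulay inverse system is $I^\perp=\{f: (g(\partial/\partial x_1,\dots,\partial/\partial x_d)f)|_{x=0}=0\text{ for all }g\in I\}$ (equivalently $f(D)g|_{0}=0$), a graded subspace. For a lattice polytope $P$ set $V_P=(\operatorname{gr}I(P\cap\mathbb{Z}^d))^\perp$. The harmonic algebra is $\mathcal{H}_P=\bigoplus_{m\ge0}\mathbb{C}x_0^m\otimes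 V_{mP}\subseteq\mathbb{C}[x_0,x_1,\dots,x_d]$, a subalgebra (multiplication $(x_0^i f)(x_0^j g)=x_0^{i+j}fg$), bigraded with $\deg x_0=(1,0)$ and $\deg x_i=(0,1)$ for $i\ge1$. The arrangement Schubert variety $Y_L$ of a linear subspace $L\subseteq\mathbb{C}^n$ is the closure of the image of $L$ under $\mathbb{C}^n\hookrightarrow(\mathbb{P}^1)^n$, $(a_1,\dots,a_n)\mapsto([a_1:1],\dots,[a_n:1])$. The Segre embedding sends $([a_1:b_1],\dots,[a_n:b_n])$ to $[c_S]_{S\subseteq[n]}$ with $c_S=\prod_{i\in S}a_i\prod_{j\notin S}b_j$; the bigrading $(1,|S|)$ on $z_S$ is preserved by $I(\Phi(Y_L))$ because $Y_L$ is stable under the $\mathbb{C}^*$-action $t\cdot([a_i:b_i])_i=([t^{-1}a_i:b_i])_i$. *)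

(* Defs.v *)
From mathcomp Require Import all_boot all_algebra.
From mathcomp Require Import reals.
From mathcomp.real_closed Require Import complex.
From mathcomp Require Import mpoly.

Set Implicit Arguments.
Unset Strict Implicit.
Unset Printing Implicit Defensive.
Import GRing.Theory Num.Theory.
Local Open Scope ring_scope.

(* A : d x n integer matrix of rank d all of whose maximal (d x d) minors
   lie in {-1,0,1}.  Minors are taken over all column selections f : 'I_d -> 'I_n
   (non-injective selections give 0, reorderings change only the sign). *)
Definition unimodular (d n : nat) (A : 'M[int]_(d, n)) : Prop :=
  \rank (map_mx (intr : int -> rat) A) = d /\
  forall f : 'I_d -> 'I_n, \det (colsub f A) \in [:: -1; 0; 1].

Definition dil_lattice_pts (R : realType) (d n : nat) (A : 'M[int]_(d, n))
    (m : nat) (x : 'cV[int]_d) : Prop :=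
  exists t : 'cV[R]_n,
    (forall j, 0 <= t j 0 <= m%:R) /\ map_mx intr A *m t = map_mx intr x.

Definition vanish_on (R : realType) (d : nat) (S : 'cV[int]_d -> Prop)
    (p : {mpoly R[i][d]}) : Prop :=
  forall x, S x -> p.@[fun k => (x k 0)%:~R] = 0.

Definition homcomp (F : fieldType) (N : nat) (k : nat) (p : {mpoly F[N]})
  : {mpoly F[N]} :=
  \sum_(m <- msupp p | mdeg m == k) p@_m *: 'X_[m].

Definition topcomp (F : fieldType) (N : nat) (p : {mpoly F[N]}) : {mpoly F[N]} :=
  homcomp (msize p).-1 p.

Definition gr_ideal (R : realType) (d : nat) (S : 'cV[int]_d -> Prop)
    (g : {mpoly R[i][d]}) : Prop :=
  exists s : seq ({mpoly R[i][d]} * {mpoly R[i][d]}),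
    (forall q, q \in s -> vanish_on S q.2) /\
    g = \sum_(q <- s) q.1 * topcomp q.2.

Definition apply_diff (F : fieldType) (N : nat) (g f : {mpoly F[N]}) : {mpoly F[N]} :=
  \sum_(m <- msupp g) g@_m *: f^`M[m].

Definition inverse_system (F : fieldType) (N : nat) (I : {mpoly F[N]} -> Prop)
    (f : {mpoly F[N]}) : Prop :=
  forall g, I g -> (apply_diff g f).@[fun _ => 0] = 0.

Definition V_dil (R : realType) (d n : nat) (A : 'M[int]_(d, n)) (m : nat)
  : {mpoly R[i][d]} -> Prop :=
  inverse_system (gr_ideal (dil_lattice_pts R A m)).

(* variable x_0 is index ord0, variable x_k (k >= 1) is index lift ord0 (k-1) *)
Definition x0_slice (F : fieldType) (d : nat) (P : {mpoly F[d.+1]}) (k : nat)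
  : {mpoly F[d]} :=
  \sum_(mo <- msupp P | mo ord0 == k)
     P@_mo *: 'X_[[multinom mo (lift ord0 j) | j < d]].

Definition harmonic (R : realType) (d n : nat) (A : 'M[int]_(d, n))
    (P : {mpoly R[i][d.+1]}) : Prop :=
  forall m : nat, V_dil A m (x0_slice P m).

Definition bihomog_H (F : fieldType) (d : nat) (a b : nat) (P : {mpoly F[d.+1]}) : Prop :=
  forall mo, mo \in msupp P -> mo ord0 = a /\ mdeg mo = (a + b)%N.

(* number of Segre coordinates z_S, S subset [n] ; z_S is the variable enum_rank S *)
Definition nsub (n : nat) : nat := #|{set 'I_n}|.

Definition subset_of (n : nat) (k : 'I_(nsub n)) : {set 'I_n} := enum_val k.

Definition rowspaceC (R : realType) (d n : nat) (A : 'M[int]_(d, n))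
    (a : 'rV[R[i]]_n) : Prop :=
  exists y : 'rV[R[i]]_d, a = y *m map_mx intr A.

(* a point of (P^1)^n is given by representatives ([a_i : b_i])_i, (a_i,b_i) <> (0,0) *)
Definition P1n_point (F : fieldType) (n : nat) (p : 'I_n -> F * F) : Prop :=
  forall i, p i != (0, 0).

Definition eval_ab (F : fieldType) (n : nat) (q : {mpoly F[n + n]})
    (p : 'I_n -> F * F) : F :=
  q.@[fun k => match split k with inl i => (p i).1 | inr i => (p i).2 end].

Definition multihomog (F : fieldType) (n : nat) (q : {mpoly F[n + n]}) : Prop :=
  exists e : 'I_n -> nat, forall mo, mo \in msupp q ->
    forall i, (mo (lshift n i) + mo (rshift n i))%N = e i.

(* Y_L : Zariski closure in (P^1)^n of the image of L under a |-> ([a_i : 1])_i *)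
Definition Y_L (R : realType) (d n : nat) (A : 'M[int]_(d, n))
    (p : 'I_n -> R[i] * R[i]) : Prop :=
  P1n_point p /\
  forall q : {mpoly R[i][n + n]}, multihomog q ->
    (forall a, rowspaceC A a -> eval_ab q (fun j => (a 0 j, 1)) = 0) ->
    eval_ab q p = 0.

Definition segre (F : fieldType) (n : nat) (p : 'I_n -> F * F) : 'I_(nsub n) -> F :=
  fun k => \prod_(j < n) (if j \in subset_of k then (p j).1 else (p j).2).

Definition I_PhiY (R : realType) (d n : nat) (A : 'M[int]_(d, n))
    (G : {mpoly R[i][nsub n]}) : Prop :=
  forall (k : nat) (p : 'I_n -> R[i] * R[i]), Y_L A p -> (homcomp k G).@[segre p] = 0.

Definition bihomog_Z (F : fieldType) (n : nat) (a b : nat) (G : {mpoly F[nsub n]}) : Prop :=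
  forall mo, mo \in msupp G ->
    mdeg mo = a /\ (\sum_(k < nsub n) mo k * #|subset_of k|)%N = b.

(* Main.v *)
(** The morphism sends z_S to x_0 times the product of the linear forms l_i given
    by the columns i of A, i in S.  Its kernel is computed by evaluating at the
    points ([l_i(y) : 1])_i, which are dense in Y_L.  Surjectivity onto the harmonic
    algebra is the equality, in each degree m, of V_mZ with the span W_m of the
    products of the l_i in which each factor is repeated at most m times.

    W_m is contained in V_mZ: pairing the product of l_i over a list t with a
    polynomial f of degree |t| computes the iterated finite difference of f along
    the columns in t, an alternating sum of values of f at lattice points of mZ.

    Conversely V_mZ has dimension at most the number N of lattice points of mZ, and
    W_m has dimension at least N by deletion-contraction: removing a column a, the
    lattice points x of the zonotope such that x + j a lies in it for some j > 0
    belong to the zonotope of the remaining columns (by convexity), while the others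
    are pairwise incongruent modulo a.  Unimodularity enters only here, to ensure
    that two congruent lattice points differ by an integral multiple of a. *)

Require Import Defs.
From HB Require Import structures.
From mathcomp Require Import all_boot all_order all_algebra.
From mathcomp Require Import boolp reals.
From mathcomp.real_closed Require Import complex.
From mathcomp Require Import ssrcomplements mpoly.
From mathcomp Require Import zify ring lra.
Set Implicit Arguments.
Unset Strict Implicit.
Unset Printing Implicit Defensive.
Import Order.TTheory GRing.Theory Num.Theory.
Local Open Scope ring_scope.

(** * The apolarity pairing and finite differences *)

Section Pairing.
Variables (F : fieldType) (N : nat).
Implicit Types (f g h p : {mpoly F[N]}) (m : 'X_{1..N}) (a : 'cV[F]_N).

(** Monomials are orthogonal for the pairing [dot], and this is the value of [dot] at the pair
    ['X_[m]], ['X_[m]]. *)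
Definition mfact m : F := (\prod_(i < N) (m i)`!)%:R.

Definition dot g f : F := (apply_diff g f).@[fun _ => 0].

Lemma meval0E p : p.@[fun _ => 0] = p@_0%MM.
Proof.
elim/mpolyind: p => [|c m p _ _ IH]; first by rewrite meval0 mcoeff0.
rewrite mevalD mevalZ mcoeffD mcoeffZ IH mevalX mcoeffX; congr (_ * _ + _).
have [->|/eqP m_n0] := eqVneq m 0%MM.
  by rewrite big1 // => i _; rewrite mnm0E expr0.
have [i mi] : exists i, m i != 0%N.
  apply/existsP; apply: contraT; rewrite negb_exists => /forallP m0.
  by case: m_n0; apply/mnmP => i; rewrite mnm0E; apply/eqP; rewrite -[_ == _]negbK m0.
by rewrite (bigD1 i) //= expr0n (negPf mi) mul0r.
Qed.

Lemma dotE g f : dot g f = \sum_(m <- msupp g) g@_m * f@_m * mfact m.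
Proof.
rewrite /dot /apply_diff raddf_sum /=; apply: eq_bigr => m _.
rewrite mevalZ meval0E mcoeff_mderivm addm0 -mulrA -mulr_natr.
by congr (_ * (_ * _%:R)); apply: eq_bigr => i _; rewrite ffactnn.
Qed.

(** A range of monomials that does not depend on the support of [g] makes the formula symmetric in
    [g] and [f]. *)
Lemma dotwE k g f : (msize g <= k)%N ->
  dot g f = \sum_(m : 'X_{1..N < k}) g@_m * f@_m * mfact m.
Proof.
move=> gk; rewrite dotE.
pose I : subFinType _ := 'X_{1..N < k}.
rewrite (big_mksub I) //=; first last.
- by move=> m /msize_mdeg_lt /leq_trans; apply.
- exact: msupp_uniq.
rewrite big_rmcond //= => m; rewrite -mcoeff_eq0 => /eqP ->.
by rewrite !mul0r.
Qed.

Lemma dotC g f : dot g f = dot f g.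
Proof.
rewrite (dotwE _ (leq_maxl (msize g) (msize f))).
rewrite (dotwE _ (leq_maxr (msize g) (msize f))).
by apply: eq_bigr => m _; rewrite (mulrC g@_m).
Qed.

Fact dot_is_linear g : scalar (dot g).
Proof.
move=> c f h; rewrite !dotE mulr_sumr -big_split /=; apply: eq_bigr => m _.
by rewrite mcoeffD mcoeffZ mulrDr mulrDl (mulrCA g@_m) -!mulrA.
Qed.

HB.instance Definition _ g :=
  GRing.isLinear.Build F {mpoly F[N]} F _ (dot g) (dot_is_linear g).

Lemma dotX m f : dot 'X_[m] f = f@_m * mfact m.
Proof. by rewrite dotE msuppX big_seq1 mcoeffX eqxx mul1r. Qed.

Lemma dotBr g f h : dot g (f - h) = dot g f - dot g h.
Proof. exact: raddfB. Qed.

Lemma dotZr c g f : dot g (c *: f) = c * dot g f.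
Proof. exact: linearZ. Qed.

Lemma dot_sumr (I : Type) (r : seq I) (P : pred I) g (G : I -> {mpoly F[N]}) :
  dot g (\sum_(i <- r | P i) G i) = \sum_(i <- r | P i) dot g (G i).
Proof. exact: raddf_sum. Qed.

Lemma dot_suml (I : Type) (r : seq I) (P : pred I) (G : I -> {mpoly F[N]}) f :
  dot (\sum_(i <- r | P i) G i) f = \sum_(i <- r | P i) dot (G i) f.
Proof. by rewrite dotC raddf_sum; apply: eq_bigr => i _; rewrite dotC. Qed.

Lemma dotZl c g f : dot (c *: g) f = c * dot g f.
Proof. by rewrite dotC linearZ /= dotC. Qed.

Lemma dot_homog k g f : g \is k.-homog -> (msize f <= k)%N -> dot g f = 0.
Proof.
move=> /dhomogP gk fk; rewrite dotE big_seq big1 // => m /gk mk.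
have -> : f@_m = 0 by apply/memN_msupp_eq0/msize_mdeg_ge; rewrite mk.
by rewrite mulr0 mul0r.
Qed.

(** On monomials, the exponent brought down by the derivative is the extra factor in the factorial
    of the longer monomial. *)
Lemma dot_mulX j p f : dot ('X_j * p) f = dot p f^`M(j).
Proof.
rewrite [p]mpolyE mulr_sumr !dot_suml; apply: eq_bigr => m _.
rewrite -scalerAr !dotZl -mpolyXD !dotX mcoeff_deriv mulrnAl -mulrnAr addmC.
congr (_ * (_ * _)); rewrite /mfact -[RHS]mulr_natr -natrM; congr _%:R.
rewrite (bigD1 j) //= [in RHS](bigD1 j) //= mnmDE mnm1E eqxx addn1 factS.
rewrite -mulnA mulnC; congr (_ * _ * _)%N.
by apply: eq_bigr => i ij; rewrite mnmDE mnm1E eq_sym (negPf ij) addn0.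
Qed.

Definition linform a : {mpoly F[N]} := \sum_j a j 0 *: 'X_j.

Definition dderiv a f := \sum_j a j 0 *: f^`M(j).

Lemma dot_linform a p f : dot (linform a * p) f = dot p (dderiv a f).
Proof.
rewrite mulr_suml dot_suml raddf_sum; apply: eq_bigr => j _.
by rewrite -scalerAl dotZl dot_mulX /= linearZ.
Qed.

Lemma dderivM a f g : dderiv a (f * g) = dderiv a f * g + f * dderiv a g.
Proof.
rewrite mulr_suml mulr_sumr -big_split; apply: eq_bigr => j _ /=.
by rewrite mderivM scalerDr scalerAl scalerAr.
Qed.

Lemma dderivXU a j : dderiv a 'X_j = (a j 0)%:MP.
Proof.
rewrite /dderiv (bigD1 j) //= big1 ?addr0 => [|i ij]; rewrite mderivX mnm1E.
  have -> : (U_(j) - U_(j) = 0)%MM by apply/mnmP => i; rewrite mnmBE mnm0E subnn.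
  by rewrite eqxx scale1r mpolyX0 alg_mpolyC.
by rewrite eq_sym (negPf ij) scale0r scaler0.
Qed.

Lemma dderiv1 a : dderiv a 1 = 0.
Proof. by rewrite /dderiv big1 // => j _; rewrite mderivC scaler0. Qed.

Lemma dderivD a f g : dderiv a (f + g) = dderiv a f + dderiv a g.
Proof.
by rewrite /dderiv -big_split; apply: eq_bigr => j _; rewrite mderivD scalerDr.
Qed.

Lemma dderivZ a c f : dderiv a (c *: f) = c *: dderiv a f.
Proof.
rewrite /dderiv scaler_sumr; apply: eq_bigr => j _.
by rewrite mderivZ !scalerA mulrC.
Qed.

Definition mshift a f : {mpoly F[N]} := f \mPo [tuple 'X_j + (a j 0)%:MP | j < N].

Lemma meval_mshift a f (x : 'cV[F]_N) :
  (mshift a f).@[fun j => x j 0] = f.@[fun j => (x + a) j 0].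
Proof.
rewrite /mshift comp_mpoly_meval; apply: meval_eq => j.
by rewrite tnth_mktuple mevalD mevalXU mevalC mxE.
Qed.

Lemma msizeD k f g : (msize f <= k)%N -> (msize g <= k)%N -> (msize (f + g) <= k)%N.
Proof. by move=> fk gk; apply: leq_trans (msizeD_le _ _) _; rewrite geq_max fk gk. Qed.

Lemma msizeMX k j f : (msize f <= k)%N -> (msize ('X_j * f) <= k.+1)%N.
Proof.
move=> fk; have [->|f0] := eqVneq f 0; first by rewrite mulr0 msize0.
have X0 : 'X_j != 0 :> {mpoly F[N]} by rewrite -msize_poly_eq0 msizeX.
by rewrite msizeM // msizeX mdeg1.
Qed.

Lemma msize_dderivX a m : (msize (dderiv a 'X_[m]) <= mdeg m)%N.
Proof.
rewrite /dderiv; apply: leq_trans (msize_sum _ _ _) _.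
apply/bigmax_leqP => j _; rewrite mderivX scalerA.
have [mj|/negbTE mj] := boolP (U_(j) <= m)%MM.
  apply: leq_trans (msizeZ_le _ _) _; rewrite msizeX.
  by rewrite -[X in (_ <= mdeg X)%N](submK mj) mdegD mdeg1 addn1.
by move: mj; rewrite lep1mP => /negbFE/eqP ->; rewrite mulr0 scale0r msize0.
Qed.

Lemma msize_dderiv a k f : (msize f <= k)%N -> (msize (dderiv a f) <= k.-1)%N.
Proof.
move=> fk; have -> : dderiv a f = \sum_(m <- msupp f) f@_m *: dderiv a 'X_[m].
  rewrite {1}[f]mpolyE; elim: (msupp f) => [|m s IH].
    by rewrite !big_nil /dderiv big1 // => j _; rewrite mderiv0 scaler0.
  by rewrite !big_cons -IH dderivD dderivZ.
apply: leq_trans (msize_sum _ _ _) _.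
apply/bigmax_leqP_seq => m fm _.
apply: leq_trans (msizeZ_le _ _) _; apply: leq_trans (msize_dderivX _ _) _.
by have := leq_trans (msize_mdeg_lt fm) fk; case: k {fk}.
Qed.

(** The remainder of the first-order Taylor expansion of [f] along [a]. *)
Definition taylor2 a f := mshift a f - f - dderiv a f.

(** The shift is multiplicative and [dderiv] is a derivation; this recursion drives the degree bound
    below. *)
Lemma taylor2MX a j g :
  taylor2 a ('X_j * g) = 'X_j * taylor2 a g + (a j 0) *: (taylor2 a g + dderiv a g).
Proof.
rewrite /taylor2 /mshift rmorphM /= comp_mpolyXU.
rewrite (nth_map (Ordinal (ltn_ord j))) ?size_enum_ord // nth_ord_enum.
rewrite dderivM dderivXU subrK -mul_mpolyC.
set s := comp_mpoly _ _; set D := dderiv _ _.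
ring.
Qed.

Lemma msize_taylor2X a m : (msize (taylor2 a 'X_[m]) <= (mdeg m).-1)%N.
Proof.
elim: {m}(mdeg m) {-2}m (erefl (mdeg m)) => [|k IH] m.
  move/eqP; rewrite mdeg_eq0 => /eqP ->.
  by rewrite /taylor2 mpolyX0 dderiv1 /mshift rmorph1 subrr subr0 msize0.
have [->|] := eqVneq m 0%MM; first by rewrite mdeg0.
move=> m0 dm.
have [j mj] : exists j, (U_(j) <= m)%MM.
  apply/existsP; apply: contraNT m0; rewrite negb_exists => /forallP m0.
  apply/eqP/mnmP => j; rewrite mnm0E; apply/eqP; have := m0 j.
  by rewrite lep1mP negbK.
move: dm; rewrite -(submK mj) addmC mdegD mdeg1 add1n => -[dm].
have {IH}IH := IH _ dm.
rewrite mpolyXD taylor2MX; apply: msizeD; last first.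
  apply: leq_trans (msizeZ_le _ _) _; apply: msizeD; last exact: msize_dderivX.
  by apply: leq_trans IH _; apply: leq_pred.
(* In degree 0 the predecessor is truncated, but there the bound already forces the remainder to
   vanish. *)
case E: (mdeg _) IH => [|l] IH /=; last exact: msizeMX.
by move: IH => /=; rewrite leqn0 msize_poly_eq0 => /eqP ->; rewrite mulr0 msize0.
Qed.

Lemma msize_taylor2 a k f : (msize f <= k)%N -> (msize (taylor2 a f) <= k.-2)%N.
Proof.
move=> fk; rewrite [f]mpolyE.
have -> : taylor2 a (\sum_(m <- msupp f) f@_m *: 'X_[m]) =
          \sum_(m <- msupp f) f@_m *: taylor2 a 'X_[m].
  elim: (msupp f) => [|m s IH].
    rewrite !big_nil /taylor2 /mshift raddf0 /dderiv big1 ?subr0 // => j _.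
    by rewrite mderiv0 scaler0.
  rewrite !big_cons -IH /taylor2 /mshift raddfD /= linearZ /= dderivD dderivZ.
  by rewrite -!mul_mpolyC; ring.
apply: leq_trans (msize_sum _ _ _) _.
apply/bigmax_leqP_seq => m fm _.
apply: leq_trans (msizeZ_le _ _) _; apply: leq_trans (msize_taylor2X _ _) _.
have := leq_trans (msize_mdeg_lt fm) fk.
by case: k {fk} => // -[|k] /=; case: (mdeg m).
Qed.

Lemma homog_linform a : linform a \is 1.-homog.
Proof.
by rewrite /linform; apply: rpred_sum => j _; apply: dhomogZ; rewrite dhomogX /= mdeg1.
Qed.

Lemma homog_prod_linform (s : seq 'cV[F]_N) :
  \prod_(a <- s) linform a \is (size s).-homog.
Proof.
elim: s => [|a s IH]; first by rewrite big_nil dhomog1.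
by rewrite big_cons; apply: dhomogM (homog_linform a) IH.
Qed.

(* The finite difference and the derivative of f along a differ by terms two
   degrees below f, which the pairing with (size s)-homogeneous forms ignores. *)
Lemma dot_prod_linform (s : seq 'cV[F]_N) f :
  (msize f <= (size s).+1)%N ->
  (forall t, subseq t s -> f.@[fun j => (\sum_(a <- t) a) j 0] = 0) ->
  dot (\prod_(a <- s) linform a) f = 0.
Proof.
elim: s f => [|a s IH] f fs f0.
  have := f0 [::] isT; rewrite (msize1_polyC fs) mevalC => ->.
  by rewrite mpolyC0 raddf0.
rewrite big_cons dot_linform.
have -> : dderiv a f = (mshift a f - f) - taylor2 a f by rewrite /taylor2 subKr.
rewrite raddfB /= [X in _ - X](_ : _ = 0) ?subr0; last first.
  apply: (@dot_homog (size s)); last exact: msize_taylor2 fs.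
  exact: homog_prod_linform.
apply: IH => [|t ts].
  rewrite -[mshift a f - f](subrK (dderiv a f)).
  apply: msizeD; last exact: msize_dderiv fs.
  by apply: leq_trans (msize_taylor2 _ fs) _; apply: leqnSn.
rewrite mevalB meval_mshift (f0 t) ?subr0; last first.
  by apply: subseq_trans ts _; apply: subseq_cons.
rewrite -(f0 (a :: t)) /=; last by rewrite eqxx.
by apply: meval_eq => j; rewrite big_cons addrC.
Qed.

End Pairing.

(** * Counting lattice points of zonotopes *)

Lemma poly_eq0_horner (F : numDomainType) (p : {poly F}) :
  (forall t, p.[t] = 0) -> p = 0.
Proof.
move=> p0; apply/eqP/negPn/negP => /max_poly_roots root_lt.
suff : (size [seq k%:R : F | k <- iota 0 (size p)] < size p)%N.
  by rewrite size_map size_iota ltnn.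
apply: root_lt; first by apply/allP => t _; apply/rootP.
by rewrite map_inj_uniq ?iota_uniq // => i j /eqP; rewrite eqr_nat => /eqP.
Qed.

Section ZonotopeCount.
Variables (R : realFieldType) (d n : nat) (A : 'M[int]_(d, n)).
Implicit Types (x y : 'cV[R]_d) (c s t : seq 'I_n) (i : 'I_n).

Definition ip x y : R := (x^T *m y) 0 0.
Definition realv (x : 'cV[int]_d) : 'cV[R]_d := map_mx intr x.
Definition colR i : 'cV[R]_d := realv (col i A).

Lemma ipDl x x' y : ip (x + x') y = ip x y + ip x' y.
Proof. by rewrite /ip linearD mulmxDl mxE. Qed.
Lemma ipZl a x y : ip (a *: x) y = a * ip x y.
Proof. by rewrite /ip linearZ -scalemxAl mxE. Qed.
Lemma ipDr x y y' : ip x (y + y') = ip x y + ip x y'.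
Proof. by rewrite /ip mulmxDr mxE. Qed.
Lemma ipZr a x y : ip x (a *: y) = a * ip x y.
Proof. by rewrite /ip -scalemxAr mxE. Qed.
Lemma ipNl x y : ip (- x) y = - ip x y.
Proof. by rewrite -scaleN1r ipZl mulN1r. Qed.
Lemma ip0l y : ip 0 y = 0.
Proof. by rewrite -(scale0r (0 : 'cV_d)) ipZl mul0r. Qed.
Lemma ip0r x : ip x 0 = 0.
Proof. by rewrite -(scale0r (0 : 'cV_d)) ipZr mul0r. Qed.

Lemma ip_realv (x y : 'cV[int]_d) : ip (realv x) (realv y) = ((x^T *m y) 0 0)%:~R.
Proof. by rewrite /ip /realv map_trmx -map_mxM mxE. Qed.

(* [annih c] is the orthogonal complement of the columns listed in c, and
   [eqmod c] is congruence modulo their span, expressed by duality. *)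
Definition annih c y := forall i, i \in c -> ip (colR i) y = 0.

Definition eqmod c x x' := forall y, annih c y -> ip x y = ip x' y.

(* The points congruent modulo span c to a point of the zonotope of s. *)
Fixpoint zono c s x : Prop :=
  if s is i :: s' then exists2 u, 0 <= u <= 1 & zono c s' (x - u *: colR i)
  else eqmod c x 0.

Lemma annih_cons i c y : annih (i :: c) y <-> ip (colR i) y = 0 /\ annih c y.
Proof.
split=> [Ky|[Hi Ky] j].
  by split=> [|j cj]; apply: Ky; rewrite inE ?eqxx // cj orbT.
by rewrite inE => /orP[/eqP ->|/Ky].
Qed.

Lemma annihD c y y' a : annih c y -> annih c y' -> annih c (y + a *: y').
Proof. by move=> Ky Ky' i ci; rewrite ipDr ipZr Ky ?Ky' // mulr0 addr0. Qed.

Lemma zono_eqmod c s x x' : eqmod c x x' -> zono c s x -> zono c s x'.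
Proof.
elim: s x x' => [|i s IH] x x' xx' /=; first by move=> x0 y Ky; rewrite -xx' ?x0.
case=> u u01 zx; exists u => //; apply: IH zx => y Ky.
by rewrite !ipDl xx'.
Qed.

Lemma zono_convex c s l x x' : 0 <= l <= 1 ->
  zono c s x -> zono c s x' -> zono c s (l *: x + (1 - l) *: x').
Proof.
move=> /andP[l0 l1]; elim: s x x' => [|i s IH] x x' /=.
  by move=> x0 x'0 y Ky; rewrite ipDl !ipZl x0 // x'0 // ip0l !mulr0 addr0.
move=> [u /andP[u0 u1] zx] [u' /andP[u'0 u'1] zx'].
exists (l * u + (1 - l) * u'); first by apply/andP; split; nra.
have := IH _ _ zx zx'; congr zono.
by apply/matrixP => j k; rewrite !mxE; ring.
Qed.

Lemma zono_between c s x a p q : p <= 0 <= q ->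
  zono c s (x + p *: a) -> zono c s (x + q *: a) -> zono c s x.
Proof.
move=> /andP[p0 q0] zp zq; have [p_eq0|p_neq0] := eqVneq p 0.
  by move: zp; rewrite p_eq0 scale0r addr0.
have p_lt0 : p < 0 by rewrite lt_neqAle p_neq0.
have qp : q - p != 0 by rewrite gt_eqF // subr_gt0 (lt_le_trans p_lt0).
have qp0 : 0 < q - p by lra.
(* The weight [l] for which [l * p + (1 - l) * q] vanishes. *)
have l01 : 0 <= q / (q - p) <= 1.
  by rewrite divr_ge0 ?(ltW qp0) //= ler_pdivrMr // mul1r; lra.
have := zono_convex l01 zp zq; congr zono.
by apply/matrixP => j k; rewrite !mxE; field.
Qed.

Lemma zono_contract c s i x : zono c s x -> zono (i :: c) s x.
Proof.
elim: s x => [|j s IH] x /=; first by move=> x0 y /annih_cons[_ /x0].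
by case=> u u01 /IH; exists u.
Qed.

Definition prodform t y := \prod_(i <- t) ip (colR i) y.

(** Independence as functions on [annih c] only: contracting a column restricts functions to its
    hyperplane. Coefficients are indexed by [nat] so that concatenating lists amounts to shifting
    indices. *)
Definition indep c (T : seq (seq 'I_n)) := forall al : nat -> R,
  (forall y, annih c y -> \sum_(k < size T) al k * prodform (nth [::] T k) y = 0) ->
  forall k, (k < size T)%N -> al k = 0.

(* A polynomial vanishing on annih c off the hyperplane of column i vanishes on
   annih c: restrict it to lines in a direction y0 transverse to the hyperplane. *)
Lemma annih_cancel c i y0 (T : seq (seq 'I_n)) (al : nat -> R) :
  annih c y0 -> ip (colR i) y0 != 0 ->
  (forall y, annih c y ->
     ip (colR i) y * \sum_(k < size T) al k * prodform (nth [::] T k) y = 0) ->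
  forall y, annih c y -> \sum_(k < size T) al k * prodform (nth [::] T k) y = 0.
Proof.
move=> Ky0 iy0 T0 y Ky.
pose l j : {poly R} := (ip (colR j) y)%:P + ip (colR j) y0 *: 'X.
pose q : {poly R} := \sum_(k < size T) al k *: \prod_(j <- nth [::] T k) l j.
have lE j (t : R) : (l j).[t] = ip (colR j) (y + t *: y0).
  by rewrite /l !hornerE ipDr ipZr mulrC.
have qE (t : R) : q.[t] = \sum_(k < size T) al k * prodform (nth [::] T k) (y + t *: y0).
  rewrite /q horner_sum; apply: eq_bigr => k _; rewrite hornerZ horner_prod.
  by congr (_ * _); apply: eq_bigr => j _; rewrite lE.
have : l i * q = 0.
  by apply: poly_eq0_horner => t; rewrite hornerM lE qE T0 //; apply: annihD.
move/eqP; rewrite mulf_eq0 => /orP[/eqP li0|/eqP q0].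
  have := lE i 1; have := lE i 0; rewrite li0 !horner0 scale0r addr0 scale1r ipDr.
  by move=> <-; rewrite add0r => /esym/eqP; rewrite (negPf iy0).
by rewrite -[y]addr0 -(scale0r y0) -qE q0 horner0.
Qed.

(** On the hyperplane of column [i] the products from [T1] vanish, which kills the coefficients of
    [T2]; the common factor of the remaining terms is then cancelled. *)
Lemma indep_cat c i y0 T1 T2 : annih c y0 -> ip (colR i) y0 != 0 ->
  indep c T1 -> indep (i :: c) T2 -> indep c (map (cons i) T1 ++ T2).
Proof.
move=> Ky0 iy0 i1 i2 al al0.
have sumE y : \sum_(k < size (map (cons i) T1 ++ T2))
    al k * prodform (nth [::] (map (cons i) T1 ++ T2) k) y =
  ip (colR i) y * \sum_(k < size T1) al k * prodform (nth [::] T1 k) y +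
  \sum_(k < size T2) al (size T1 + k)%N * prodform (nth [::] T2 k) y.
  rewrite size_cat size_map big_split_ord /=; congr (_ + _).
    rewrite mulr_sumr; apply: eq_bigr => k _.
    rewrite nth_cat size_map ltn_ord (nth_map [::]) //.
    by rewrite /prodform big_cons mulrCA.
  apply: eq_bigr => k _.
  by rewrite nth_cat size_map ltnNge leq_addr /= addKn.
have al2 k : (k < size T2)%N -> al (size T1 + k)%N = 0.
  apply: (i2 (fun k => al (size T1 + k)%N)) => y /annih_cons[iy Ky].
  by have := al0 y Ky; rewrite sumE iy mul0r add0r.
have al1 k : (k < size T1)%N -> al k = 0.
  apply: i1; apply: annih_cancel Ky0 iy0 _ => y Ky.
  have := al0 y Ky; rewrite sumE [X in _ + X]big1 ?addr0 // => j _.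
  by rewrite al2 // mul0r.
move=> k; rewrite size_cat size_map => kT.
have [/al1 //|kT1] := ltnP k (size T1).
by rewrite -(subnKC kT1); apply: al2; rewrite ltn_subLR.
Qed.

Hypothesis A_unimodular : forall c i y, annih c y -> ip (colR i) y != 0 ->
  exists2 y0 : 'cV[int]_d, annih c (realv y0) & ip (colR i) (realv y0) = 1.

(** The list [c] records the contracted columns, and [X] has at most one point in each class modulo
    their span. For empty [c] this last condition is automatic. *)
Lemma zonotope_count s c (X : seq 'cV[int]_d) : uniq X ->
  {in X, forall x : 'cV[int]_d, zono c s (realv x)} ->
  {in X &, forall x x' : 'cV[int]_d, eqmod c (realv x) (realv x') -> x = x'} ->
  exists T, [/\ size T = size X, all (subseq^~ s) T & indep c T].
Proof.
elim: s c X => [|i s IH] c X uX zX eqX.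
  (* Without columns the zonotope is a single class, so [X] has at most one point, accounted for by
     the empty product 1. *)
  case: X uX zX eqX => [|x [|x' X]] uX zX eqX.
  - by exists [::].
  - exists [:: [::]]; split=> // al al0 [|//] _.
    have := al0 0 (fun i _ => ip0r _).
    by rewrite big_ord_recl big_ord0 /prodform big_nil mulr1 addr0.
  - move: uX => /= /andP[]; rewrite inE negb_or => /andP[/eqP[]].
    apply: eqX; rewrite ?inE ?eqxx ?orbT // => y Ky.
    by rewrite !zX ?inE ?eqxx ?orbT.
have [[y [Ky iy]]|noy] := pselect (exists y, annih c y /\ ip (colR i) y != 0);
    last first.
  have [x xX|T [sT Ts iT]] := IH c X uX _ eqX.
    have [u u01 zx] := zX x xX; apply: zono_eqmod zx => y Ky.
    rewrite ipDl ipNl ipZl; suff -> : ip (colR i) y = 0 by rewrite mulr0 subr0.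
    by apply: contra_notP noy => /eqP; exists y.
  exists T; split=> //; apply/allP => t /(allP Ts) /subseq_trans; apply.
  exact: subseq_cons.
have [y0 Ky0 iy0] := A_unimodular Ky iy.
(* Points with another point of [X] further along column [i] go to the deletion; the last ones on
   their lines go to the contraction. *)
pose above (x x' : 'cV[int]_d) :=
  exists2 j : int, 0 < j & eqmod c (realv x') (realv x + j%:~R *: colR i).
pose lower (x : 'cV[int]_d) := `[< exists2 x', x' \in X & above x x' >].
have [x|x x'|T1 [sT1 Ts1 iT1]] := IH c [seq x <- X | lower x] (filter_uniq _ uX).
- rewrite mem_filter => /andP[/asboolP[x' x'X [j j0 xx']] xX].
  have [u /andP[u0 u1] zx] := zX x xX; have [u' /andP[u'0 u'1] zx'] := zX x' x'X.
  have j1 : 1 <= j%:~R :> R by rewrite ler1z.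
  (* The interval contains 0 because [0 <= u] and [u' <= 1 <= j]. *)
  apply: (@zono_between _ _ _ (colR i) (- u) (j%:~R - u')).
  + by apply/andP; split; lra.
  + by rewrite scaleNr.
  + apply: zono_eqmod zx' => y' Ky'.
    by rewrite ipDl xx' // !ipDl ipNl !ipZl; ring.
- by rewrite !mem_filter => /andP[_ xX] /andP[_ x'X]; apply: eqX.
have [x|x x'|T2 [sT2 Ts2 iT2]] :=
  IH (i :: c) [seq x <- X | ~~ lower x] (filter_uniq _ uX).
- rewrite mem_filter => /andP[_ /zX /= [u u01 /(zono_contract i) zx]].
  apply: zono_eqmod zx => y' /annih_cons[iy' _].
  by rewrite ipDl ipNl ipZl iy' mulr0 subr0.
- rewrite !mem_filter => /andP[lx xX] /andP[lx' x'X] xx'.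
  (* Since [y0] takes the value 1 on column [i], it reads off the multiple of that column separating
     [x] from [x'] modulo [c]; this is an integer because [y0] is integral. *)
  pose j := ((x' - x)^T *m y0) 0 0.
  have jE : j%:~R = ip (realv (x' - x)) (realv y0) by rewrite ip_realv.
  have xjx' : eqmod c (realv x') (realv x + j%:~R *: colR i).
    (* Correcting [y'] by a multiple of [y0] makes it orthogonal to column [i] as well, so that the
       congruence modulo [i :: c] applies. *)
    move=> y' Ky'; have := xx' (y' + (- ip (colR i) y') *: realv y0).
    rewrite !(ipDr, ipZr) ipDl ipZl jE /realv raddfB /= ipDl ipNl -!/(realv _).
    have Ky'' : annih (i :: c) (y' + (- ip (colR i) y') *: realv y0).
      apply/annih_cons; split; last exact: annihD.
      by rewrite ipDr ipZr iy0; ring.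
    by move=> /(_ Ky''); lra.
  have [j0|j0|j0] := ltrgt0P j.
  + by move: lx => /asboolP[]; exists x' => //; exists j.
  + move: lx' => /asboolP[]; exists x => //; exists (- j); first by rewrite oppr_gt0.
    by move=> y' Ky'; rewrite ipDl ipZl (xjx' y' Ky') ipDl ipZl rmorphN /=; ring.
  + apply: eqX => // y' Ky'.
    by rewrite (xjx' y' Ky') j0 scale0r addr0.
exists (map (cons i) T1 ++ T2); split.
- by rewrite size_cat size_map sT1 sT2 !size_filter count_predC.
- rewrite all_cat all_map; apply/andP; split.
    by apply/allP => t /(allP Ts1) /= ts; rewrite eqxx.
  by apply/allP => t /(allP Ts2) /subseq_trans; apply; apply: subseq_cons.
- by apply: indep_cat Ky0 _ iT1 iT2; rewrite iy0 oner_eq0.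
Qed.

End ZonotopeCount.

(** * Integral dual vectors of a unimodular matrix *)

Section UnimodularDual.
Variables (R : realFieldType) (d n : nat) (A : 'M[int]_(d, n)).
Hypothesis uA : unimodular A.
Implicit Types (y : 'cV[R]_d).

Lemma row_free_unimodular : row_free (map_mx intr A : 'M[R]_(d, n)).
Proof.
case: uA => rA _; rewrite /row_free -[X in _ == X]rA -(mxrank_map (@ratr R)).
rewrite -map_mx_comp; apply/eqP; congr (\rank _).
by apply/matrixP => i j; rewrite !mxE /= ratr_int.
Qed.

Lemma ip_colRE (j : 'I_n) y : ip (colR R A j) y = ((map_mx intr A)^T *m y) j 0.
Proof. by rewrite /ip !mxE; apply: eq_bigr => k _; rewrite !mxE. Qed.

Lemma annih_all y : (forall j, ip (colR R A j) y = 0) -> y = 0.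
Proof.
move=> y0; apply: trmx_inj; apply: (row_free_inj row_free_unimodular).
rewrite trmx0 mul0mx; apply: trmx_inj; rewrite trmx_mul !trmxK trmx0.
by apply/matrixP => j k; rewrite ord1 -ip_colRE y0 mxE.
Qed.

(* Enlarging c to a maximal set of columns whose span misses column i leaves a
   single candidate y up to scaling, and Cramer's rule makes it integral. *)
Lemma unimodular_dual (c : seq 'I_n) (i : 'I_n) y :
  annih A c y -> ip (colR R A i) y != 0 ->
  exists2 y0 : 'cV[int]_d, annih A c (realv R y0) & ip (colR R A i) (realv R y0) = 1.
Proof.
move=> Ky iy.
pose P (C : {set 'I_n}) :=
  `[< exists2 y, forall j, j \in C -> ip (colR R A j) y = 0 & ip (colR R A i) y != 0 >].
have Pc : P [set j in c] by apply/asboolP; exists y => // j; rewrite inE; apply: Ky.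
have [C /maxsetP[/asboolP[y1' Cy1' iy1'] maxC] cC] := maxset_exists Pc.
pose y1 := (ip (colR R A i) y1')^-1 *: y1'.
have iy1 : ip (colR R A i) y1 = 1 by rewrite ipZr mulVf.
have Cy1 j : j \in C -> ip (colR R A j) y1 = 0.
  by move=> jC; rewrite ipZr (Cy1' j) // mulr0.
(* For [j] outside [C], maximality forces [y1] to be nonzero on column [j]. Then [z - e *: y1] kills
   [C] and column [j], hence also column [i], where its value is [- e]; so [e] is 0. *)
have Cker z : (forall j, j \in i |: C -> ip (colR R A j) z = 0) -> z = 0.
  move=> z0; apply: annih_all => j; have [jC|jC] := boolP (j \in C).
    by apply: z0; rewrite inE jC orbT.
  have ajC : ~ P (j |: C).
    by move=> /maxC /(_ (subsetUr _ _)) jCE; rewrite -jCE !inE eqxx in jC.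
  have ajy1 : ip (colR R A j) y1 != 0.
    apply: contra_notN ajC => /eqP jy1; apply/asboolP; exists y1.
      by move=> k; rewrite !inE => /orP[/eqP -> //|]; apply: Cy1.
    by rewrite iy1 oner_eq0.
  pose e := ip (colR R A j) z / ip (colR R A j) y1.
  have : ip (colR R A i) (z - e *: y1) = 0.
    apply: contra_notP ajC => /eqP H; apply/asboolP; exists (z - e *: y1) => //.
    move=> k; rewrite -scaleNr ipDr ipZr !inE => /orP[/eqP ->|kC].
      by rewrite mulNr divfK ?subrr.
    by rewrite z0 ?inE ?kC ?orbT // Cy1 // mulr0 addr0.
  rewrite -scaleNr ipDr ipZr iy1 z0 ?inE ?eqxx // add0r mulr1 => /eqP.
  by rewrite oppr_eq0 mulf_eq0 invr_eq0 (negPf ajy1) orbF => /eqP.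
(* Zeroing the other rows ensures that an invertible selection of rows uses only columns of [A]
   indexed by [i |: C]. *)
pose B : 'M[R]_(n, d) := \matrix_(j, k) (if j \in i |: C then (A k j)%:~R else 0).
have BE j z : j \in i |: C -> (B *m z) j 0 = ip (colR R A j) z.
  by move=> jC; rewrite ip_colRE !mxE; apply: eq_bigr => k _; rewrite !mxE jC.
have fullB : row_full B.
  suff : \rank (cokermx B) = 0%N.
    rewrite mxrank_coker => /eqP; rewrite subn_eq0 => dB.
    by rewrite /row_full eqn_leq rank_leq_col dB.
  apply/eqP; rewrite mxrank_eq0; apply/eqP/matrixP => k l; rewrite [RHS]mxE.
  have -> : cokermx B k l = col l (cokermx B) k 0 by rewrite [RHS]mxE.
  rewrite (Cker (col l (cokermx B))) ?mxE // => j jC.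
  by rewrite -BE // colE mulmxA mulmx_coker mul0mx mxE.
pose f := fullrankfun fullB.
have uB : rowsub f B \in unitmx by rewrite -row_full_unit fullrowsub_full.
have fC k : f k \in i |: C.
  apply: contraLR uB => fk; rewrite unitmxE unitfE negbK (expand_det_row _ k).
  by rewrite big1 // => l _; rewrite !mxE (negPf fk) mul0r.
pose Bz : 'M[int]_d := (colsub f A)^T.
have BzE : rowsub f B = map_mx intr Bz.
  by apply/matrixP => k l; rewrite !mxE fC.
have uBz : Bz \in unitmx.
  move: uB; rewrite BzE !unitmxE det_map_mx unitfE intr_eq0 /Bz det_tr.
  by case: uA => _ /(_ f); rewrite !inE => /or3P[] /eqP ->.
(* The values of [y1] on the selected columns. They are integers and [Bz] is invertible over the
   integers, hence [y1] is integral. *)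
pose w : 'cV[int]_d := \col_k (f k == i)%:R.
have wE : map_mx intr w = rowsub f B *m y1.
  apply/matrixP => k l; rewrite ord1 mul_rowsub_mx mxE [RHS]mxE mxE BE //.
  have [->|fi] := eqVneq (f k) i; first by rewrite iy1.
  by rewrite Cy1 //; have := fC k; rewrite !inE (negPf fi).
have y1E : realv R (invmx Bz *m w) = y1.
  apply: (can_inj (mulKmx uB)); rewrite -wE BzE /realv -map_mxM /=.
  by rewrite mulKVmx.
exists (invmx Bz *m w); rewrite y1E // => j jc.
by apply: Cy1; apply: (subsetP cC); rewrite inE.
Qed.

End UnimodularDual.

(** * The inverse system of a finite set of points *)

Local Notation "p ^conj" := (map_mpoly Num.conj p) (at level 2, format "p ^conj").

Section HermitianPairing.
Variables (C : numClosedFieldType) (N : nat).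
Implicit Types (f g p : {mpoly C[N]}).

Lemma mfact_gt0 (m : 'X_{1..N}) : 0 < mfact C m :> C.
Proof. by rewrite ltr0n prodn_gt0 // => i; apply: fact_gt0. Qed.

(** The pairing is a sum of squared moduli of coefficients weighted by positive factorials.
    Conjugation supplies the definiteness that the bilinear [dot] lacks. *)
Lemma dot_conj_eq0 p : dot p p^conj = 0 -> p = 0.
Proof.
rewrite dotE big_seq => /eqP; rewrite psumr_eq0 => [/allP p0|m _]; last first.
  by rewrite mcoeff_map_mpoly mulr_ge0 ?mul_conjC_ge0 // ltW ?mfact_gt0.
apply: msuppnil0; case E: (msupp p) => [//|m s].
have := p0 m; rewrite E inE eqxx => /(_ isT) /=.
rewrite mcoeff_map_mpoly mulf_eq0 mul_conjC_eq0 (gt_eqF (mfact_gt0 m)) orbF.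
by rewrite mcoeff_eq0 E inE eqxx.
Qed.

Lemma dot_eq0 p : (forall m, dot 'X_[m] p = 0) -> p = 0.
Proof.
move=> p0; apply/mpolyP => m; rewrite mcoeff0; apply/eqP.
by have /eqP := p0 m; rewrite dotX mulf_eq0 (gt_eqF (mfact_gt0 m)) orbF.
Qed.

Lemma mconj_linform (a : 'cV[C]_N) :
  map_mx Num.conj a = a -> (linform a)^conj = linform a.
Proof.
move=> aE; rewrite /linform rmorph_sum /=; apply: eq_bigr => j _.
by rewrite map_mpolyZ map_mpolyX -[in RHS]aE mxE.
Qed.

End HermitianPairing.

(** * Spanning an inverse system by real forms *)

Section InverseSystemSpan.
Variables (R : realType) (d N : nat) (S : 'cV[int]_d -> Prop) (X : 'I_N -> 'cV[int]_d).
Variables (f : 'I_N -> {mpoly R[i][d]}) (e : 'I_N -> nat).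
Hypothesis S_sub_X : forall x, S x -> exists k, x = X k.
Hypothesis f_homog : forall k, f k \is (e k).-homog.
Hypothesis f_real : forall k, (f k)^conj = f k.
Hypothesis f_free : forall c : 'I_N -> R[i], \sum_k c k *: f k = 0 -> forall k, c k = 0.
Hypothesis f_inverse : forall k, inverse_system (gr_ideal S) (f k).
Implicit Types (c : 'I_N -> R[i]) (h v : {mpoly R[i][d]}).

(** Either [k] is the top degree of [h], or the component is zero. *)
Lemma gr_ideal_homcomp k h : (msize h <= k.+1)%N -> vanish_on S h ->
  gr_ideal S (homcomp k h).
Proof.
move=> hk h0; have [kh|] := ltnP k (msize h).
  have -> : k = (msize h).-1 by apply/eqP; rewrite -eqSS (ltn_predK kh) eqn_leq kh hk.
  exists [:: (1, h)]; split; last by rewrite big_seq1 mul1r.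
  by move=> q; rewrite inE => /eqP ->.
move=> kh; exists [::]; split=> //; rewrite big_nil /homcomp big_seq_cond big1 // => m.
move=> /andP[/msize_mdeg_lt /leq_trans /(_ kh)]; rewrite ltnNge => /negPf mk /eqP mE.
by rewrite mE leqnn in mk.
Qed.

Lemma homcompE k h : homcomp k h = pihomog mdeg k h.
Proof. by []. Qed.

Lemma homcomp_comb k c :
  homcomp k (\sum_j c j *: f j) = \sum_(j | e j == k) c j *: f j.
Proof.
rewrite homcompE raddf_sum [RHS]big_mkcond; apply: eq_bigr => j _ /=.
rewrite linearZ /=; have [<-|ek] := eqVneq; first by rewrite pihomog_dE.
by rewrite (pihomog_ne0 ek (f_homog j)) scaler0.
Qed.

(** As the [f j] are real, the conjugate of the combination lies in the inverse system, so the
    combination pairs to zero with its conjugate. *)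
Lemma comb_gr_ideal_eq0 k c : gr_ideal S (\sum_(j | e j == k) c j *: f j) ->
  \sum_(j | e j == k) c j *: f j = 0.
Proof.
move=> grI; apply: dot_conj_eq0.
rewrite [X in dot _ X]rmorph_sum raddf_sum big1 //= => j _.
by rewrite map_mpolyZ f_real linearZ /= [dot _ _](f_inverse j grI) mulr0.
Qed.

Lemma topcomp_eq0 h : topcomp h = 0 -> h = 0.
Proof.
move=> top0; apply/eqP/negPn/negP => h0.
have := mlead_supp h0; rewrite mcoeff_msupp => lh0.
have := congr1 (mcoeff (mlead h)) top0; rewrite mcoeff0.
rewrite /topcomp -(mlead_deg h0) /= /homcomp raddf_sum /= -big_filter.
rewrite (bigD1_seq (mlead h)) /= ?mem_filter ?eqxx ?mlead_supp ?filter_uniq //.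
rewrite mcoeffZ mcoeffX eqxx mulr1 big1 => [/eqP|m mh].
  by rewrite addr0 (negPf lh0).
by rewrite mcoeffZ mcoeffX (negPf mh) mulr0.
Qed.

(** The top component of the combination is again a combination of the [f j] and lies in the ideal.
    This gives the injectivity of evaluation at the points. *)
Lemma comb_vanish_eq0 c : vanish_on S (\sum_j c j *: f j) -> forall j, c j = 0.
Proof.
move=> van; apply: f_free; apply: topcomp_eq0; rewrite /topcomp homcomp_comb.
apply: comb_gr_ideal_eq0; rewrite -homcomp_comb.
by apply: gr_ideal_homcomp => //; apply: leqSpred.
Qed.

(** Interpolation: evaluating the [N] forms at the [N] points gives an invertible square matrix. *)
Lemma monomial_mod_vanish m : exists2 c,
  vanish_on S ('X_[m] - \sum_j c j *: f j) &
  (msize ('X_[m] - \sum_j c j *: f j) <= (mdeg m).+1)%N.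
Proof.
pose ev (p : {mpoly R[i][d]}) : 'rV[R[i]]_N :=
  \row_k p.@[fun l => (X k l 0)%:~R].
pose E : 'M[R[i]]_N := \matrix_(j, k) ev (f j) 0 k.
have evE (c : 'rV_N) : ev (\sum_j c 0 j *: f j) = c *m E.
  apply/rowP => k; rewrite !mxE raddf_sum; apply: eq_bigr => j _ /=.
  by rewrite mevalZ !mxE.
have ev0 p : ev p = 0 -> vanish_on S p.
  by move=> p0 x /S_sub_X[k ->]; have /rowP/(_ k) := p0; rewrite !mxE.
have uE : E \in unitmx.
  rewrite -row_free_unit -kermx_eq0; apply/eqP/row_matrixP => r; rewrite row0.
  have : row r (kermx E) *m E = 0 by rewrite -row_mul mulmx_ker row0.
  rewrite -evE => /ev0/comb_vanish_eq0 c0; apply/rowP => k.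
  by rewrite [RHS]mxE c0.
pose c := ev 'X_[m] *m invmx E; pose h := 'X_[m] - \sum_j c 0 j *: f j.
have hv : vanish_on S h.
  apply: ev0; apply/rowP => k; have /rowP/(_ k) := evE c.
  by rewrite /c mulmxKV // !mxE mevalB => ->; rewrite subrr.
exists (fun j => c 0 j); first exact: hv.
rewrite -/h.
(* If the degree were larger, the top component of [h] would be a combination of the [f j] lying in
   the ideal, hence zero. *)
rewrite leqNgt; apply/negP => mh.
have topE : topcomp h = \sum_(j | e j == (msize h).-1) (- c 0 j) *: f j.
  rewrite /topcomp /h -homcomp_comb !homcompE raddfB /=.
  rewrite pihomogX ifN; last by rewrite neq_ltn -ltnS (ltn_predK mh) mh.
  rewrite sub0r -raddfN /= -sumrN; congr (pihomog _ _ _).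
  by apply: eq_bigr => j _; rewrite scaleNr.
have h0 : h = 0.
  apply: topcomp_eq0; rewrite topE; apply: comb_gr_ideal_eq0; rewrite -topE.
  by apply: gr_ideal_homcomp => //; apply: leqSpred.
by rewrite h0 msize0 in mh.
Qed.

(** Modulo the ideal each monomial is a combination of the [f j]: take the component of degree
    [mdeg m] in the interpolation. *)
Lemma inverse_system_dot_eq0 v : inverse_system (gr_ideal S) v ->
  (forall j, dot (f j) v = 0) -> v = 0.
Proof.
move=> Vv fv; apply: dot_eq0 => m.
have [c hv hm] := monomial_mod_vanish m.
have := Vv _ (gr_ideal_homcomp hm hv).
rewrite -/(dot _ v) homcompE raddfB /= pihomogX eqxx -homcompE homcomp_comb dotC.
rewrite dotBr dot_sumr big1 => [|j _]; first by rewrite subr0 dotC.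
by rewrite dotZr dotC fv mulr0.
Qed.

(** The Gram matrix of the [f j] is invertible because they are real and free; removing the
    projection of [v] to their span leaves an element orthogonal to all of them. *)
Lemma inverse_system_span v : inverse_system (gr_ideal S) v ->
  exists c, v = \sum_j c j *: f j.
Proof.
move=> Vv; pose G : 'M[R[i]]_N := \matrix_(k, j) dot (f j) (f k).
have GE (c : 'rV_N) j : (c *m G) 0 j = dot (f j) (\sum_k c 0 k *: f k).
  by rewrite mxE dot_sumr; apply: eq_bigr => k _; rewrite mxE dotZr.
have uG : G \in unitmx.
  rewrite -row_free_unit -kermx_eq0; apply/eqP/row_matrixP => r; rewrite row0.
  have : row r (kermx G) *m G = 0 by rewrite -row_mul mulmx_ker row0.
  set c := row r _ => cG0.
  suff /f_free c0 : \sum_k c 0 k *: f k = 0 by apply/rowP => k; rewrite c0 mxE.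
  apply: dot_conj_eq0; rewrite [X in dot _ X]rmorph_sum dot_sumr big1 //= => j _.
  by rewrite map_mpolyZ f_real dotZr dotC -GE cG0 [X in _ * X]mxE mulr0.
pose c := (\row_j dot (f j) v) *m invmx G; exists (fun j => c 0 j).
apply/eqP; rewrite -subr_eq0; apply/eqP/inverse_system_dot_eq0 => [g grg|j].
  rewrite -/(dot g _) dotBr [dot g v](Vv g grg) dot_sumr big1 ?subrr // => k _.
  by rewrite dotZr [dot g _](f_inverse k grg) mulr0.
by rewrite dotBr -GE mulmxKV // mxE subrr.
Qed.

End InverseSystemSpan.

(** * The inverse system of a dilated unimodular zonotope *)

Section ZonotopePoints.
Variables (R : realType) (d n : nat) (A : 'M[int]_(d, n)) (m : nat).

(** The dilate of the zonotope by [m] is the zonotope of the columns each repeated [m] times. *)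
Definition copies : seq 'I_n := flatten [seq nseq m i | i <- enum 'I_n].

Lemma count_copies i : count_mem i copies = m.
Proof.
rewrite /copies count_flatten -map_comp sumnE big_map big_enum /= (bigD1 i) //=.
rewrite count_nseq /= eqxx mul1n big1 ?addn0 // => j ji.
by rewrite count_nseq /= (negPf ji) mul0n.
Qed.

Lemma zono_nseq c s i k (x : 'cV[R]_d) t : 0 <= t <= k%:R ->
  zono A c s (x - t *: colR R A i) -> zono A c (nseq k i ++ s) x.
Proof.
elim: k t x => [|k IH] t x /andP[t0 tk] /= zx.
  by have t_eq0 : t = 0 by [lra]; rewrite t_eq0 scale0r subr0 in zx.
have k1 : 0 < k.+1%:R :> R by rewrite ltr0Sn.
(* The coefficient is shared equally among the [k.+1] copies. *)
exists (t / k.+1%:R).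
  by rewrite divr_ge0 ?(ltW k1) //= ler_pdivrMr // mul1r.
apply: (IH (t * k%:R / k.+1%:R)).
  rewrite divr_ge0 ?mulr_ge0 ?ler0n ?(ltW k1) //=.
  by rewrite ler_pdivrMr // mulrC ler_wpM2l ?ler0n.
rewrite -addrA -opprD -scalerDl.
have -> : t / k.+1%:R + t * k%:R / k.+1%:R = t; last by [].
by rewrite -mulrDl -[X in X + _]mulr1 -mulrDr -natr1 addrC mulfK // natr1 gt_eqF.
Qed.

Lemma zono_copies x : dil_lattice_pts R A m x -> zono A [::] copies (realv R x).
Proof.
case=> t [t01 Ax].
have xE : realv R x = \sum_(i <- enum 'I_n) t i 0 *: colR R A i.
  rewrite /realv -Ax big_enum; apply/matrixP => k l; rewrite ord1 summxE !mxE.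
  by apply: eq_bigr => i _; rewrite !mxE mulrC.
rewrite xE /copies; elim: (enum 'I_n) => [|i s IH]; first by rewrite big_nil.
rewrite big_cons /=; apply: (@zono_nseq _ _ _ _ _ (t i 0)) => //.
by rewrite addrAC subrr add0r.
Qed.

Lemma dil_lattice_sum t : (forall i, (count_mem i t <= m)%N) ->
  dil_lattice_pts R A m (\sum_(i <- t) col i A).
Proof.
move=> tm; exists (\col_i (count_mem i t)%:R); split=> [i|].
  by rewrite mxE ler0n ler_nat tm.
rewrite raddf_sum /=; elim: t {tm} => [|i t IH].
  rewrite big_nil (_ : \col__ _ = 0) ?mulmx0 //.
  by apply/matrixP => k l; rewrite !mxE.
rewrite big_cons -IH /=.
rewrite (_ : \col_j _ = delta_mx i 0 + \col_j (count_mem j t)%:R).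
  by rewrite mulmxDr -colE map_col.
by apply/matrixP => k l; rewrite !mxE natrD ord1 eqxx andbT eq_sym.
Qed.

Lemma dil_lattice_finite : exists X : seq 'cV[int]_d,
  uniq X /\ forall x, x \in X <-> dil_lattice_pts R A m x.
Proof.
(* A crude bound on the coordinates; [g] enumerates the box of integer vectors with entries between
   [- B] and [B]. *)
pose B := (\sum_k \sum_j `|A k j| * m)%N.
pose g (M : {ffun 'I_d -> 'I_(B + B).+1}) : 'cV[int]_d := \col_k (Posz (M k) - Posz B).
exists (undup [seq x <- codom g | `[< dil_lattice_pts R A m x >] ]).
split=> [|x]; first exact: undup_uniq.
rewrite mem_undup mem_filter; split=> [/andP[/asboolP]//|dx].
apply/andP; split; first exact/asboolP.
have xB k : `|x k 0| <= Posz B.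
  case: dx => t [t01 Ax].
  have : (x k 0)%:~R = \sum_j (A k j)%:~R * t j 0 :> R.
    have /matrixP/(_ k 0) := Ax; rewrite !mxE => <-.
    by apply: eq_bigr => j _; rewrite mxE.
  move=> xE; rewrite -(ler_int R) intr_norm xE; apply: le_trans (ler_norm_sum _ _ _) _.
  rewrite -pmulrn /B (bigD1 k) //= natrD natr_sum.
  apply: ler_wpDr; first by rewrite ler0n.
  apply: ler_sum => j _; have /andP[t0 tm] := t01 j.
  rewrite normrM (ger0_norm t0) natrM pmulrn abszE intr_norm.
  by rewrite ler_wpM2l.
apply/codomP; exists [ffun k => inord (absz (x k 0 + Posz B))].
apply/matrixP => k l; rewrite ord1 mxE ffunE inordK; have := xB k; lia.
Qed.

End ZonotopePoints.

(** * Products of column forms in the inverse system *)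

Section ZonotopalSpace.
Variables (R : realType) (d n : nat) (A : 'M[int]_(d, n)).

Definition colform (i : 'I_n) : {mpoly R[i][d]} := linform (map_mx intr (col i A)).

Definition prodcol (t : seq 'I_n) := \prod_(i <- t) colform i.

Lemma homog_prodcol t : prodcol t \is (size t).-homog.
Proof.
rewrite /prodcol -(big_map (fun i => map_mx intr (col i A)) xpredT (@linform _ _)).
rewrite -(size_map (fun i => map_mx intr (col i A) : 'cV[R[i]]_d)).
exact: homog_prod_linform.
Qed.

Lemma mconj_prodcol t : map_mpoly Num.conj (prodcol t) = prodcol t.
Proof.
rewrite rmorph_prod; apply: eq_bigr => i _; rewrite /= mconj_linform //.
by apply/matrixP => k l; rewrite !mxE rmorph_int.
Qed.

Lemma vanish_prodcol_eq0 m t (f : {mpoly R[i][d]}) :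
  (forall i, (count_mem i t <= m)%N) -> (msize f <= (size t).+1)%N ->
  vanish_on (dil_lattice_pts R A m) f -> dot (prodcol t) f = 0.
Proof.
move=> tm ft f0; pose g i : 'cV[R[i]]_d := map_mx intr (col i A).
have -> : prodcol t = \prod_(a <- map g t) linform a by rewrite big_map.
apply: dot_prod_linform => [|s]; first by rewrite size_map.
case/subseqP => b _ ->; rewrite -map_mask big_map.
rewrite -[RHS](f0 (\sum_(i <- mask b t) col i A)).
  by apply: meval_eq => k; rewrite !summxE raddf_sum; apply: eq_bigr => i _; rewrite !mxE.
apply: dil_lattice_sum => i; apply: leq_trans (tm i).
exact/leq_count_subseq/mask_subseq.
Qed.

Lemma dot_homog_neq k l (g f : {mpoly R[i][d]}) : k != l ->
  g \is k.-homog -> f \is l.-homog -> dot g f = 0.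
Proof.
move=> kl /dhomogP gk /dhomogP fl; rewrite dotE big_seq big1 // => m gm.
suff -> : f@_m = 0 by rewrite mulr0 mul0r.
apply: memN_msupp_eq0; apply: contra kl => fm.
by rewrite -(gk m gm) -(fl m fm).
Qed.

Lemma topcomp_homog (f : {mpoly R[i][d]}) : topcomp f \is ((msize f).-1).-homog.
Proof. exact: pihomogP. Qed.

Lemma msize_sub_topcomp (f : {mpoly R[i][d]}) : (msize (f - topcomp f) <= (msize f).-1)%N.
Proof.
have -> : f - topcomp f = \sum_(m <- msupp f | mdeg m != (msize f).-1) f@_m *: 'X_[m].
  apply/eqP; rewrite subr_eq addrC; apply/eqP.
  by rewrite {1}[f]mpolyE (bigID (fun m => mdeg m == (msize f).-1)).
apply: leq_trans (msize_sum _ _ _) _; apply/bigmax_leqP_seq => m fm me.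
apply: leq_trans (msizeZ_le _ _) _; rewrite msizeX ltn_neqAle me /=.
by have := msize_mdeg_lt fm; case: (msize f).
Qed.

(** By linearity the multiplier is a monomial ['X_[mu]]. In the degree of [prodcol t], replacing
    [topcomp f] by [f] only adds terms of lower degree, which pair to zero, and ['X_[mu] * f] still
    vanishes at the lattice points. *)
Lemma V_dil_prodcol m t : (forall i, (count_mem i t <= m)%N) ->
  V_dil A m (prodcol t).
Proof.
move=> tm g [s [s0 ->]]; rewrite -/(dot _ _) dot_suml big_seq big1 // => -[h f] /s0 /= f0.
rewrite [h]mpolyE mulr_suml dot_suml big1 // => mu _.
rewrite -scalerAl dotZl; apply/eqP; rewrite mulf_eq0; apply/orP; right; apply/eqP.
have hom : 'X_[mu] * topcomp f \is (mdeg mu + (msize f).-1).-homog.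
  by apply: dhomogM (topcomp_homog f); rewrite dhomogX.
have [et|] := eqVneq (mdeg mu + (msize f).-1)%N (size t); last first.
  by move=> neq; apply: dot_homog_neq neq hom (homog_prodcol t).
have msizeXM k (p : {mpoly R[i][d]}) :
    (msize p <= k)%N -> (msize ('X_[mu] * p) <= mdeg mu + k)%N.
  have [->|p0 pk] := eqVneq p 0; first by rewrite mulr0 msize0.
  have X0 : 'X_[mu] != 0 :> {mpoly R[i][d]} by rewrite -msize_poly_eq0 msizeX.
  by rewrite msizeM // msizeX addSn /= leq_add2l.
have -> : topcomp f = f - (f - topcomp f) by rewrite subKr.
rewrite mulrBr dotC dotBr (vanish_prodcol_eq0 tm); first last.
- by move=> x /f0 fx; rewrite mevalM fx mulr0.
- by rewrite -et -addnS; apply: msizeXM; apply: leqSpred.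
rewrite sub0r (dot_homog (homog_prodcol t)) ?oppr0 // -et.
exact/msizeXM/msize_sub_topcomp.
Qed.

Local Notation toC := (real_complex R).

Lemma meval_prodcol t (y : 'cV[R]_d) :
  (prodcol t).@[fun k => toC (y k 0)] = toC (prodform A t y).
Proof.
rewrite /prodcol /prodform [LHS]rmorph_prod [RHS]rmorph_prod; apply: eq_bigr => i _ /=.
rewrite /colform /linform raddf_sum /ip mxE raddf_sum; apply: eq_bigr => k _ /=.
by rewrite mevalZ mevalXU !mxE rmorphM /= rmorph_int.
Qed.

Lemma Re_mul_real (z : R[i]) r : complex.Re (z * toC r) = complex.Re z * r.
Proof. by case: z => a b /=; rewrite mulr0 subr0. Qed.

Lemma Im_mul_real (z : R[i]) r : complex.Im (z * toC r) = complex.Im z * r.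
Proof. by case: z => a b /=; rewrite mulr0 add0r. Qed.

Hypothesis uA : unimodular A.

(** The count provides as many independent products as there are lattice points, which is what
    [inverse_system_span] requires. *)
Lemma V_dil_span m (v : {mpoly R[i][d]}) : V_dil A m v ->
  exists (T : seq (seq 'I_n)) (c : 'I_(size T) -> R[i]),
    (forall t, t \in T -> forall i, (count_mem i t <= m)%N) /\
    v = \sum_k c k *: prodcol (nth [::] T k).
Proof.
have [X [uX Xdil]] := dil_lattice_finite R A m => Vv.
have [x /Xdil|x x' xX x'X xx'|T [sT Ts iT]] :=
    @zonotope_count R d n A (unimodular_dual uA) (copies n m) [::] X uX.
- exact: zono_copies.
- have K0 (y : 'cV[R]_d) : annih A [::] y by [].
  apply/matrixP => k l; rewrite ord1; have := xx' (delta_mx k 0) (K0 _).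
  by rewrite /ip -!colE !mxE => /intr_inj.
have Tm t : t \in T -> forall i, (count_mem i t <= m)%N.
  by move=> /(allP Ts) ts i; rewrite -(count_copies m i); apply: leq_count_subseq.
pose f k := prodcol (nth [::] T k).
have [x /Xdil xX|k|k|c c0 k|k||c vE] :=
    @inverse_system_span R d (size T) (dil_lattice_pts R A m)
      (fun k => nth 0 X k) f (fun k => size (nth [::] T k)) _ _ _ _ _ v.
- have xT : (index x X < size T)%N by rewrite sT index_mem.
  by exists (Ordinal xT); rewrite /= nth_index.
- exact: homog_prodcol.
- exact: mconj_prodcol.
(* Independence is known over the reals with coefficients indexed by [nat]: pad by 0 and treat real
   and imaginary parts separately. *)
- pose al (h : R[i] -> R) j := if insub j is Some j' then h (c j') else 0.
  have alE h (j : 'I_(size T)) : al h j = h (c j) by rewrite /al valK.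
  have ev y : \sum_k c k * toC (prodform A (nth [::] T k) y) = 0.
    have := congr1 (meval (fun k => toC (y k 0))) c0.
    rewrite meval0 raddf_sum /= => {2}<-; apply: eq_bigr => j _.
    by rewrite mevalZ meval_prodcol.
  have Re_eq0 : complex.Re (c k) = 0.
    rewrite -(alE (@complex.Re R)); apply: iT => // y _.
    have := congr1 (@complex.Re R) (ev y).
    rewrite (big_morph (@complex.Re R) (id1 := 0) (op1 := +%R)) //; last by case=> ? ? [].
    move=> H; rewrite -[RHS](H : _ = 0); apply: eq_bigr => j _.
    by rewrite alE Re_mul_real.
  have Im_eq0 : complex.Im (c k) = 0.
    rewrite -(alE (@complex.Im R)); apply: iT => // y _.
    have := congr1 (@complex.Im R) (ev y).
    rewrite (big_morph (@complex.Im R) (id1 := 0) (op1 := +%R)) //; last by case=> ? ? [].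
    move=> H; rewrite -[RHS](H : _ = 0); apply: eq_bigr => j _.
    by rewrite alE Im_mul_real.
  by move: Re_eq0 Im_eq0; case: (c k) => a b /= -> ->.
- by apply: V_dil_prodcol; apply: Tm; rewrite mem_nth.
- exact: Vv.
by exists T, c.
Qed.

End ZonotopalSpace.

(** * The morphism *)

(** The leading monomial is a product of coordinate forms, so pairing with it both extracts the
    leading coefficient and is a finite difference of values of [p]. *)
Lemma mpoly_eq0_meval (C : numClosedFieldType) N (p : {mpoly C[N]}) :
  (forall x : 'cV[C]_N, p.@[fun j => x j 0] = 0) -> p = 0.
Proof.
move=> p0; apply/eqP/negPn/negP => nz_p.
have := mlead_supp nz_p; rewrite mcoeff_msupp => /negP; apply; apply/eqP.
have := mlead_deg nz_p; set m := mlead p => mE.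
pose s := flatten [seq nseq (m i) (delta_mx i 0 : 'cV[C]_N) | i <- enum 'I_N].
have sE : \prod_(a <- s) linform a = 'X_[m].
  rewrite mpolyXE_id /s big_flatten big_map big_enum; apply: eq_bigr => i _.
  rewrite big_nseq iter_mulr_1; congr (_ ^+ _).
  rewrite /linform (bigD1 i) //= big1 => [|j ji].
    by rewrite addr0 mxE !eqxx scale1r.
  by rewrite mxE (negPf ji) scale0r.
have sm : size s = mdeg m.
  rewrite /s size_flatten /shape -map_comp sumnE big_map big_enum mdegE.
  by apply: eq_bigr => i _; rewrite /= size_nseq.
have : dot (\prod_(a <- s) linform a) p = 0.
  by apply: dot_prod_linform => [|t _]; [rewrite sm mE | apply: p0].
by rewrite sE dotX => /eqP; rewrite mulf_eq0 (gt_eqF (mfact_gt0 _ m)) orbF => /eqP.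
Qed.

(** * Decomposition by powers of the first variable *)

Section Slices.
Variables (F : fieldType) (d : nat).
Implicit Types (P Q : {mpoly F[d.+1]}) (p : {mpoly F[d]}).

Definition mcons k (m : 'X_{1..d}) : 'X_{1..d.+1} :=
  [multinom (if unlift ord0 i is Some j then m j else k) | i < d.+1].

Definition mbehead (m : 'X_{1..d.+1}) : 'X_{1..d} :=
  [multinom m (lift ord0 j) | j < d].

Lemma mcons0 k m : mcons k m ord0 = k.
Proof. by rewrite mnmE unlift_none. Qed.

Lemma mconsS k m j : mcons k m (lift ord0 j) = m j.
Proof. by rewrite mnmE liftK. Qed.

Lemma mcons_eq k m (mu : 'X_{1..d.+1}) :
  (mu == mcons k m) = (mu ord0 == k) && (mbehead mu == m).
Proof.
apply/eqP/andP => [->|[/eqP <- /eqP <-]].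
  by rewrite mcons0; split=> //; apply/eqP/mnmP => j; rewrite mnmE mconsS.
apply/mnmP => i; case: (unliftP ord0 i) => [j|] ->; last by rewrite mcons0.
by rewrite mconsS mnmE.
Qed.

Lemma mdeg_mbehead (mu : 'X_{1..d.+1}) : mdeg mu = (mu ord0 + mdeg (mbehead mu))%N.
Proof.
by rewrite !mdegE big_ord_recl; congr (_ + _)%N; apply: eq_bigr => j _; rewrite mnmE.
Qed.

Lemma mcoeff_x0_slice P k m : (x0_slice P k)@_m = P@_(mcons k m).
Proof.
rewrite /x0_slice raddf_sum /=.
transitivity (\sum_(mu <- msupp P) if mu == mcons k m then P@_mu else 0).
  rewrite big_mkcond; apply: eq_bigr => mu _; rewrite mcons_eq.
  case: eqP => //= _; rewrite mcoeffZ mcoeffX -/(mbehead _).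
  by case: eqP => _; rewrite ?mulr1 ?mulr0.
have [Pm|Pm] := boolP (mcons k m \in msupp P).
  rewrite (bigD1_seq (mcons k m)) ?msupp_uniq //= eqxx big1 ?addr0 // => mu.
  by move=> /negPf ->.
rewrite (memN_msupp_eq0 Pm) big_seq big1 // => mu Pmu.
by case: eqP => // muE; rewrite -muE Pmu in Pm.
Qed.

Lemma mcoeff_of_slice P mu : P@_mu = (x0_slice P (mu ord0))@_(mbehead mu).
Proof.
rewrite mcoeff_x0_slice; congr (_ @__); apply/eqP.
by rewrite mcons_eq !eqxx.
Qed.

Lemma eq_x0_slice P Q : (forall k, x0_slice P k = x0_slice Q k) -> P = Q.
Proof. by move=> PQ; apply/mpolyP => mu; rewrite !mcoeff_of_slice PQ. Qed.

Definition slice k P := x0_slice P k.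

Lemma sliceE k P : x0_slice P k = slice k P.
Proof. by []. Qed.

Fact slice_is_linear k : linear (slice k).
Proof.
move=> c P Q; apply/mpolyP => m.
by rewrite mcoeffD mcoeffZ !mcoeff_x0_slice mcoeffD mcoeffZ.
Qed.

HB.instance Definition _ k :=
  GRing.isLinear.Build F {mpoly F[d.+1]} {mpoly F[d]} _ (slice k) (slice_is_linear k).

Lemma slice_eq0 k P : (msize P <= k)%N -> slice k P = 0.
Proof.
move=> Pk; apply/mpolyP => m; rewrite mcoeff_x0_slice mcoeff0.
apply/memN_msupp_eq0/msize_mdeg_ge; apply: leq_trans Pk _.
by rewrite mdeg_mbehead mcons0 leq_addr.
Qed.

Definition embS p : {mpoly F[d.+1]} := p \mPo [tuple 'X_(lift ord0 j) | j < d].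

HB.instance Definition _ := GRing.RMorphism.copy embS
  (comp_mpoly [tuple 'X_(lift ord0 j) | j < d]).
HB.instance Definition _ := GRing.Linear.copy embS
  (comp_mpoly [tuple 'X_(lift ord0 j) | j < d]).

Lemma embSX a m : 'X_ord0 ^+ a * embS 'X_[m] = 'X_[mcons a m].
Proof.
rewrite /embS comp_mpolyX [RHS]mpolyXE_id big_ord_recl mcons0; congr (_ * _).
by apply: eq_bigr => j _; rewrite tnth_mktuple mconsS.
Qed.

Lemma slice_embS a k p : slice k ('X_ord0 ^+ a * embS p) = if a == k then p else 0.
Proof.
have -> : 'X_ord0 ^+ a * embS p = \sum_(m <- msupp p) p@_m *: 'X_[mcons a m].
  rewrite {1}[p]mpolyE raddf_sum mulr_sumr; apply: eq_bigr => m _ /=.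
  by rewrite linearZ /= -scalerAr embSX.
rewrite raddf_sum /=.
have sl m : slice k 'X_[mcons a m] = if a == k then 'X_[m] else 0.
  apply/mpolyP => mu; rewrite mcoeff_x0_slice mcoeffX mcons_eq mcons0.
  have -> : mbehead (mcons a m) = m.
    by apply/mnmP => j; rewrite mnmE mconsS.
  by case: eqP => _; rewrite ?mcoeffX ?mcoeff0.
under eq_bigr do rewrite linearZ /= sl.
case: eqP => _; first by rewrite -mpolyE.
by rewrite big1 // => m _; rewrite scaler0.
Qed.

End Slices.

(** * The Segre morphism, its image and its kernel *)

Section SegreMorphism.
Variables (R : realType) (d n : nat) (A : 'M[int]_(d, n)).
Implicit Types (G : {mpoly R[i][nsub n]}).
Local Notation colform := (colform R A).
Local Notation prodcol := (prodcol R A).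

Definition segre_form := [tuple \prod_(i in subset_of k) colform i | k < nsub n].

Definition segre_hom G : {mpoly R[i][d.+1]} :=
  G \mPo [tuple 'X_ord0 * embS (tnth segre_form k) | k < nsub n].

HB.instance Definition _ := GRing.RMorphism.copy segre_hom
  (comp_mpoly [tuple 'X_ord0 * embS (tnth segre_form k) | k < nsub n]).
HB.instance Definition _ := GRing.Linear.copy segre_hom
  (comp_mpoly [tuple 'X_ord0 * embS (tnth segre_form k) | k < nsub n]).

Definition monom_cols (m : 'X_{1..nsub n}) : seq 'I_n :=
  flatten [seq flatten (nseq (m k) (enum (subset_of k))) | k <- enum 'I_(nsub n)].

Lemma comp_segre_formX m : 'X_[m] \mPo segre_form = prodcol (monom_cols m).
Proof.
rewrite comp_mpolyX /prodcol /monom_cols big_flatten big_map big_enum.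
apply: eq_bigr => k _; rewrite tnth_mktuple big_flatten /= big_nseq iter_mulr_1.
by rewrite big_enum.
Qed.

Lemma size_monom_cols m :
  size (monom_cols m) = (\sum_(k < nsub n) m k * #|subset_of k|)%N.
Proof.
rewrite size_flatten /shape -map_comp sumnE big_map big_enum; apply: eq_bigr => k _ /=.
by rewrite size_flatten /shape map_nseq sumn_nseq -cardE mulnC.
Qed.

(** Each factor [z_S] contributes at most one copy of [i], since [S] is a set. *)
Lemma count_monom_cols m i : (count_mem i (monom_cols m) <= mdeg m)%N.
Proof.
rewrite count_flatten -map_comp sumnE big_map big_enum mdegE; apply: leq_sum => k _ /=.
rewrite count_flatten map_nseq sumn_nseq -[X in (_ <= X)%N]mul1n leq_mul2r.
by rewrite count_uniq_mem ?enum_uniq // leq_b1 orbT.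
Qed.

Lemma segre_homX m : segre_hom 'X_[m] = 'X_ord0 ^+ mdeg m * embS ('X_[m] \mPo segre_form).
Proof.
rewrite /segre_hom !comp_mpolyX rmorph_prod mdegE -prodrXr -big_split.
by apply: eq_bigr => k _ /=; rewrite tnth_mktuple exprMn rmorphXn.
Qed.

(** Each Segre coordinate carries exactly one factor [x_0]. *)
Lemma slice_segre_hom k G : slice k (segre_hom G) = homcomp k G \mPo segre_form.
Proof.
have -> : segre_hom G = \sum_(m <- msupp G) G@_m *: segre_hom 'X_[m].
  rewrite {1}[G]mpolyE [LHS](raddf_sum segre_hom).
  by apply: eq_bigr => m _; rewrite /= linearZ.
rewrite /homcomp [LHS]raddf_sum [RHS]raddf_sum [RHS]big_mkcond; apply: eq_bigr => m _ /=.
rewrite !linearZ /= segre_homX slice_embS.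
by case: eqP => // _; rewrite scaler0.
Qed.

Lemma slice_segre_homE k G :
  slice k (segre_hom G) =
  \sum_(m <- msupp G | mdeg m == k) G@_m *: prodcol (monom_cols m).
Proof.
rewrite slice_segre_hom /homcomp raddf_sum; apply: eq_bigr => m _ /=.
by rewrite linearZ /= comp_segre_formX.
Qed.

Lemma segre_hom_harmonic G : harmonic A (segre_hom G).
Proof.
move=> k; rewrite [x0_slice _ _](slice_segre_homE k G) => g grg.
rewrite -/(dot g _) dot_sumr big1 // => m /eqP mk.
rewrite dotZr [dot _ _](V_dil_prodcol _ grg) ?mulr0 // => i.
by rewrite -mk; apply: count_monom_cols.
Qed.

Lemma prodcol_count t : prodcol t = \prod_i colform i ^+ count_mem i t.
Proof.
elim: t => [|j t IH]; first by rewrite /prodcol big_nil big1.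
rewrite /prodcol big_cons -/(prodcol t) IH /=.
under [RHS]eq_bigr do rewrite exprD.
rewrite [RHS]big_split /=; congr (_ * _).
rewrite (bigD1 j) //= eqxx expr1 big1 ?mulr1 // => i ij.
by rewrite eq_sym (negPf ij).
Qed.

Lemma segre_hom_prodcol k t : (forall i, (count_mem i t <= k)%N) ->
  exists G, segre_hom G = 'X_ord0 ^+ k * embS (prodcol t).
Proof.
(* Cut the multiset [t] into [k] layers, the layer [r] being the columns that occur more than [r]
   times; column [i] lies in [count_mem i t] of them. *)
move=> tk; pose S r := enum_rank [set i | (r < count_mem i t)%N].
exists (\prod_(r < k) 'X_(S r)).
rewrite rmorph_prod /=.
under eq_bigr => r _ do
  rewrite /segre_hom comp_mpolyXU -tnth_nth !tnth_mktuple /subset_of enum_rankK.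
rewrite big_split /= prodr_const card_ord -rmorph_prod; congr (_ * embS _).
rewrite prodcol_count; under eq_bigr do rewrite big_mkcond.
rewrite exchange_big; apply: eq_bigr => i _ /=.
rewrite -big_mkcond /=; under eq_bigl do rewrite inE.
rewrite prodr_const; congr (_ ^+ _).
rewrite -[RHS](card_ord (count_mem i t)) -!sum1_card.
by rewrite (big_ord_widen_cond k xpredT (fun _ => 1%N)).
Qed.

Lemma segre_hom_surj P : unimodular A -> harmonic A P -> exists G, segre_hom G = P.
Proof.
move=> uA hP.
have : forall k, exists G, segre_hom G = 'X_ord0 ^+ k * embS (x0_slice P k).
  move=> k; have [T [c [Tk ->]]] := V_dil_span uA (hP k).
  have : forall j : 'I_(size T), exists G,
      segre_hom G = 'X_ord0 ^+ k * embS (prodcol (nth [::] T j)).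
    by move=> j; apply: segre_hom_prodcol; apply: Tk; rewrite mem_nth.
  move=> /boolp.choice[G GE]; exists (\sum_j c j *: G j).
  rewrite !raddf_sum mulr_sumr; apply: eq_bigr => j _ /=.
  by rewrite !linearZ /= GE scalerAr.
move=> /boolp.choice[G GE]; exists (\sum_(k < msize P) G k).
apply: eq_x0_slice => k.
rewrite !sliceE [segre_hom _](raddf_sum segre_hom) [slice _ _](raddf_sum (slice k)).
under eq_bigr do rewrite /= GE slice_embS.
have [kP|Pk] := ltnP k (msize P); last first.
  rewrite slice_eq0 // big1 // => j _; case: eqP => // jk.
  by have := ltn_ord j; rewrite jk ltnNge Pk.
rewrite (bigD1 (Ordinal kP)) //= eqxx big1 ?addr0 // => j jk.
by case: eqP => // jE; case/eqP: jk; apply: val_inj.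
Qed.

Lemma segre_hom_eq0 G :
  segre_hom G = 0 <-> forall k, homcomp k G \mPo segre_form = 0.
Proof.
split=> [G0 k|G0]; first by rewrite -slice_segre_hom G0 raddf0.
by apply: eq_x0_slice => k; rewrite !sliceE raddf0 slice_segre_hom G0.
Qed.

Lemma meval_segre_form (H : {mpoly R[i][nsub n]}) (y : 'rV[R[i]]_d) :
  (H \mPo segre_form).@[fun j => y 0 j] =
  H.@[segre (fun j => ((y *m map_mx intr A) 0 j, 1))].
Proof.
rewrite comp_mpoly_meval; apply: meval_eq => k; rewrite tnth_mktuple rmorph_prod.
rewrite /segre [LHS]big_mkcond; apply: eq_bigr => i _ /=; case: ifP => // _.
rewrite /colform /linform raddf_sum mxE; apply: eq_bigr => j _ /=.
by rewrite mevalZ mevalXU !mxE mulrC.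
Qed.

Definition segre_poly (H : {mpoly R[i][nsub n]}) : {mpoly R[i][n + n]} :=
  H \mPo [tuple \prod_(j < n) 'X_(if j \in subset_of k then lshift n j else rshift n j)
         | k < nsub n].

Lemma eval_ab_segre_poly H p : eval_ab (segre_poly H) p = H.@[segre p].
Proof.
rewrite /eval_ab comp_mpoly_meval; apply: meval_eq => k.
rewrite tnth_mktuple rmorph_prod; apply: eq_bigr => j _ /=.
by rewrite mevalXU; case: ifP => _; rewrite ?(unsplitK (inl j)) ?(unsplitK (inr j)).
Qed.

(** For every [i], a Segre coordinate contains exactly one of [a_i] and [b_i], so the degree in each
    pair is [k]. *)
Lemma multihomog_segre_poly k G : multihomog (segre_poly (homcomp k G)).
Proof.
exists (fun=> k) => mo.
rewrite /segre_poly /homcomp raddf_sum -big_filter => /msupp_sum_le /flattenP[s].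
rewrite filter_predT => /mapP[m].
rewrite mem_filter => /andP[/eqP mk _] ->; rewrite /= comp_mpolyZ => /msuppZ_le.
rewrite comp_mpolyX; under eq_bigr do rewrite tnth_mktuple mprodXE.
rewrite mprodXnE => /mem_msuppXP <- i.
rewrite !mnm_sumE -big_split -mk mdegE; apply: eq_bigr => l _ /=.
rewrite !mulmnE -mulnDl !mnm_sumE -big_split (bigD1 i) //= big1 => [|j ji].
  rewrite addn0 !mnm1E; case: ifP => _.
    by rewrite eqxx eq_lrshift mul1n.
  by rewrite eq_rlshift eqxx mul1n.
rewrite !mnm1E; case: ifP => _.
  by rewrite eq_lshift (negPf ji) eq_lrshift.
by rewrite eq_rlshift eq_rshift (negPf ji).
Qed.

(** If the image is zero, the pullbacks of the components of [G] are among the multihomogeneous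
    equations defining the closure. Conversely [Y_L] contains the image of [L], and a polynomial
    vanishing at every [y] is zero. *)
Lemma segre_hom_ker G : segre_hom G = 0 <-> I_PhiY A G.
Proof.
rewrite segre_hom_eq0; split=> [G0 k p [_ Yp]|G0 k].
  rewrite -eval_ab_segre_poly; apply: Yp; first exact: multihomog_segre_poly.
  by move=> _ [y ->]; rewrite eval_ab_segre_poly -meval_segre_form G0 meval0.
apply: mpoly_eq0_meval => x.
rewrite (_ : _.@[_] = (homcomp k G \mPo segre_form).@[fun j => x^T 0 j]); last first.
  by apply: meval_eq => j; rewrite mxE.
rewrite meval_segre_form; apply: G0; split=> [j|q _]; last by apply; exists x^T.
by rewrite xpair_eqE oner_eq0 andbF.
Qed.

Lemma segre_hom_bihomog a b G : bihomog_Z a b G -> bihomog_H a b (segre_hom G).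
Proof.
move=> Gab mo; rewrite mcoeff_msupp mcoeff_of_slice sliceE slice_segre_homE mdeg_mbehead.
set m := mbehead mo; set k := mo ord0 => nz.
have ka : k = a.
  apply/eqP; apply: contraNT nz => ka; rewrite big_seq_cond big1 ?mcoeff0 //.
  by move=> mu /andP[/Gab[-> _]]; rewrite eq_sym (negPf ka).
split=> //; rewrite ka; congr (_ + _)%N.
suff /dhomogP : \sum_(mu <- msupp G | mdeg mu == k) G@_mu *: prodcol (monom_cols mu)
    \is b.-homog by apply; rewrite mcoeff_msupp.
rewrite big_seq_cond; apply: rpred_sum => mu /andP[/Gab[_ <-] _]; apply: dhomogZ.
by rewrite -size_monom_cols; apply: homog_prodcol.
Qed.

End SegreMorphism.

(* H_Z ~= C[z_S]/I(Phi(Y_L)) as bigraded C-algebras, stated as: there is a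
   bigraded C-algebra homomorphism C[z_S] -> C[x_0..x_d] with image H_Z and
   kernel I(Phi(Y_L)). *)
Theorem theorem1p4 (R : realType) (d n : nat) (A : 'M[int]_(d, n)) :
  unimodular A ->
  exists phi : {mpoly R[i][nsub n]} -> {mpoly R[i][d.+1]},
    (forall G H, phi (G + H) = phi G + phi H) /\
    (forall (c : R[i]) G, phi (c *: G) = c *: phi G) /\
    phi 1 = 1 /\
    (forall G H, phi (G * H) = phi G * phi H) /\
    (forall G, harmonic A (phi G)) /\
    (forall P, harmonic A P -> exists G, phi G = P) /\
    (forall G, phi G = 0 <-> I_PhiY A G) /\
    (forall a b G, bihomog_Z a b G -> bihomog_H a b (phi G)).
Proof.
move=> uA; exists (segre_hom A); split; first exact: raddfD.
split; first by move=> c G; apply: comp_mpolyZ.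
split; first exact: rmorph1.
split; first exact: rmorphM.
split; first exact: segre_hom_harmonic.
split; first by move=> P; apply: segre_hom_surj.
by split; [exact: segre_hom_ker | exact: segre_hom_bihomog].
Qed.
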